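(* Consider the single-segment ($m=1$) total-energy platooning problem with arbitrary $n$ in which all vehicles have the same usage rate, $\delta_j=\delta$ for all $j$: minimize $\sum_{j=1}^n D_1\delta(1-\eta_{[j]})$ over permutations $([1],\ldots,[n])$ of $(1,\ldots,n)$ subject to $S_{j1}-\frac{\delta}{C_j}D_1(1-\eta_{[j]})\ge\beta_j$ for all $j$. Rule 1 solves this problem in $O(n\log n)$ time, by either showing the infeasibility of the problem or finding an optimal solution if the problem is feasible.
   Context: Setting. There are $n$ vehicles and one road segment of length $D_1>0$. Vehicle $j$ has battery capacity $C_j>0$, usage rate $\delta_j>0$, initial state of charge $S_{j1}\in[0,1]$, and minimum allowable state of charge $\beta_j$ with $0\le\beta_j<S_{j1}$. Platoon positions have usage-rate reductions $0\le\eta_1\le\cdots\le\eta_n<1$. In a solution, $[j]$ is the position of vehicle $j$, its energy usage is $D_1\delta_j(1-\eta_{[j]})$, and its final state of charge is $S_{j1}-D_1\delta_j(1-\eta_{[j]})/C_j$. A solution is feasible if each final state of charge is at least $\beta_j$; the problem is infeasible if there is no feasible solution. The allowable energy usage of vehicle $j$ is $A_j=C_j(S_{j1}-\beta_j)$. Rule 1: Reindex the vehicles in non-increasing order of $A_j$ and assign vehicle $j$ to the $j$th position, for $j=1,\ldots,n$. (If the resulting assignment is not feasible, infeasibility is reported.) Running time counts elementary arithmetic operations and comparisons. *)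

(* Defs.v *)
From mathcomp Require Import all_boot all_order all_algebra all_fingroup.
Set Implicit Arguments.
Unset Strict Implicit.
Unset Printing Implicit Defensive.
Import Order.TTheory GRing.Theory Num.Theory.
Local Open Scope ring_scope.

(* Vehicles and positions are both numbered from 0, by ['I_n]. *)
Record instance (R : realFieldType) (n : nat) := Instance {
  seg_len : R;             (* D_1 *)
  capacity : 'I_n -> R;    (* C_j *)
  usage_rate : 'I_n -> R;  (* delta_j *)
  init_soc : 'I_n -> R;    (* S_{j1} *)
  min_soc : 'I_n -> R;     (* beta_j *)
  reduction : 'I_n -> R    (* eta_k, indexed by positions *)
}.

Section Problem.
Variables (R : realFieldType) (n : nat) (I : instance R n).
Implicit Types (p : 'S_n) (j k l : 'I_n).

Definition valid_instance : Prop :=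
  [/\ 0 < seg_len I,
      forall j, 0 < capacity I j /\ 0 < usage_rate I j,
      forall j, 0 <= init_soc I j <= 1 /\ 0 <= min_soc I j < init_soc I j,
      forall k l, (k <= l)%N -> reduction I k <= reduction I l
    & forall k, 0 <= reduction I k < 1].

(* A solution is a permutation [p], with [p j] the position [j] of vehicle j. *)
Definition energy_usage p j : R :=
  seg_len I * usage_rate I j * (1 - reduction I (p j)).

Definition final_soc p j : R := init_soc I j - energy_usage p j / capacity I j.

Definition total_energy p : R := \sum_j energy_usage p j.

Definition feasible p : Prop := forall j, min_soc I j <= final_soc p j.

Definition infeasible : Prop := ~ exists p, feasible p.

Definition optimal p : Prop :=
  feasible p /\ forall q : 'S_n, feasible q -> total_energy p <= total_energy q.

Definition allowable_energy j : R := capacity I j * (init_soc I j - min_soc I j).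

(* [(p^-1)%g k] is the vehicle in position k, i.e. the vehicle that receives
   index k in the reindexing.  Ties between allowable energies may be broken
   arbitrarily, so several [p] may qualify. *)
Definition rule1_assignment p : Prop :=
  forall k l, (k <= l)%N ->
    allowable_energy ((p^-1)%g l) <= allowable_energy ((p^-1)%g k).

(* [None] stands for a report of infeasibility. *)
Definition rule1_outcome (o : option 'S_n) : Prop :=
  match o with
  | Some p => rule1_assignment p /\ feasible p
  | None => exists2 p, rule1_assignment p & ~ feasible p
  end.

Definition solves (o : option 'S_n) : Prop :=
  match o with
  | Some p => optimal p
  | None => infeasible
  end.

Definition platoon_order p : seq 'I_n := [seq (p^-1)%g k | k <- enum 'I_n].

End Problem.

Variant arith_op := Sub | Mul | Div | Add.

(* A program is the tree of its elementary steps.  [Step] is a loop-control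
   test (is a list exhausted?); it is charged as a comparison, so that list
   traversal is not free. *)
Inductive prog (R T : Type) : Type :=
| Ret of T
| Arith of arith_op & R & R & (R -> prog R T)
| Leq of R & R & (bool -> prog R T)
| Step of prog R T.
Arguments Ret {R T}.

Fixpoint bind (R T U : Type) (m : prog R T) (f : T -> prog R U) : prog R U :=
  match m with
  | Ret t => f t
  | Arith o x y k => Arith o x y (fun z => bind (k z) f)
  | Leq x y k => Leq x y (fun b => bind (k b) f)
  | Step m' => Step (bind m' f)
  end.

Section Semantics.
Variables (R : realFieldType) (T : Type).

Definition eval_op (o : arith_op) (x y : R) : R :=
  match o with
  | Sub => x - y
  | Mul => x * y
  | Div => x / y
  | Add => x + y
  end.

Fixpoint run (m : prog R T) : T :=
  match m with
  | Ret t => t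
  | Arith o x y k => run (k (eval_op o x y))
  | Leq x y k => run (k (x <= y))
  | Step m' => run m'
  end.

Fixpoint time (m : prog R T) : nat :=
  match m with
  | Ret _ => 0
  | Arith o x y k => (time (k (eval_op o x y))).+1
  | Leq x y k => (time (k (x <= y))).+1
  | Step m' => (time m').+1
  end.

End Semantics.

Section Program.
Variables (R : realFieldType) (n : nat) (I : instance R n).

Local Notation keyed := (R * 'I_n)%type.

Fixpoint init_runs (js : seq 'I_n) : prog R (seq (seq keyed)) :=
  Step match js with
  | [::] => Ret [::]
  | j :: js' =>
      Arith Sub (init_soc I j) (min_soc I j) (fun d =>
      Arith Mul (capacity I j) d (fun a =>
      bind (init_runs js') (fun rs => Ret ([:: (a, j)] :: rs))))
  end.

Fixpoint merge_runs (s1 : seq keyed) : seq keyed -> prog R (seq keyed) :=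
  fix merge_s1 (s2 : seq keyed) : prog R (seq keyed) :=
  Step match s1, s2 with
  | [::], _ => Ret s2
  | _, [::] => Ret s1
  | x1 :: s1', x2 :: s2' =>
      Leq x2.1 x1.1 (fun b =>
        if b then bind (merge_runs s1' s2) (fun s => Ret (x1 :: s))
        else bind (merge_s1 s2') (fun s => Ret (x2 :: s)))
  end.

Fixpoint merge_pairs (rs : seq (seq keyed)) : prog R (seq (seq keyed)) :=
  Step match rs with
  | r1 :: r2 :: rs' =>
      bind (merge_runs r1 r2) (fun r =>
      bind (merge_pairs rs') (fun rs'' => Ret (r :: rs'')))
  | _ => Ret rs
  end.

(* [fuel] only ensures termination; as the number of runs decreases at each
   pass, the initial number of runs is enough and the last case is not met. *)
Fixpoint merge_all (fuel : nat) (rs : seq (seq keyed)) : prog R (seq keyed) :=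
  Step match rs, fuel with
  | [::], _ => Ret [::]
  | [:: r], _ => Ret r
  | _, fuel'.+1 => bind (merge_pairs rs) (merge_all fuel')
  | _, 0%N => Ret [::]
  end.

(* The vehicles of [s] are put in the positions [ks], in this order, and each
   final state of charge is compared with the minimum allowed. *)
Fixpoint check_order (s : seq keyed) (ks : seq 'I_n) :
    prog R (option (seq 'I_n)) :=
  Step match s, ks with
  | (_, j) :: s', k :: ks' =>
      Arith Mul (seg_len I) (usage_rate I j) (fun u =>
      Arith Sub 1 (reduction I k) (fun r =>
      Arith Mul u r (fun e =>
      Arith Div e (capacity I j) (fun q =>
      Arith Sub (init_soc I j) q (fun f =>
      Leq (min_soc I j) f (fun b =>
        if b then bind (check_order s' ks') (fun o => Ret (omap (cons j) o))
        else Ret None))))))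
  | _, _ => Ret (Some [::])
  end.

Definition rule1_prog : prog R (option (seq 'I_n)) :=
  bind (init_runs (enum 'I_n)) (fun rs =>
  bind (merge_all n rs) (fun s => check_order s (enum 'I_n))).

End Program.

(* Main.v *)
Require Import Defs.
From mathcomp Require Import all_boot all_order all_algebra all_fingroup.
From mathcomp Require Import boolp classical_sets reals topology normedtype.
From mathcomp Require Import landau sequences exp.
From mathcomp Require Import zify.
Set Implicit Arguments.
Unset Strict Implicit.
Unset Printing Implicit Defensive.
Import Order.TTheory GRing.Theory Num.Theory.
Import numFieldNormedType.Exports.
Local Open Scope classical_set_scope.
Local Open Scope ring_scope.

(* With a common usage rate delta, the total energy is D_1 delta times the sum
   of all 1 - eta_k, whatever the permutation, so every feasible solution is
   optimal.  If the Rule 1 assignment fails at position k, then the n - k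
   vehicles in positions >= k all have an allowable energy below the usage at
   position k; usages being non-increasing, any feasible solution would have to
   fit these n - k vehicles into the n - k - 1 positions after k.
   The program is a bottom-up merge sort: each pass over the runs takes linear
   time and halves their number. *)

(** * Optimality of Rule 1 by a counting argument *)

Section Rule1.
Variables (R : realFieldType) (n : nat) (I : instance R n) (delta : R).
Hypothesis validI : valid_instance I.
Hypothesis usageE : forall j, usage_rate I j = delta.

Let position_usage (k : 'I_n) : R := seg_len I * delta * (1 - reduction I k).

Let energy_usageE (p : 'S_n) j : energy_usage I p j = position_usage (p j).
Proof. by rewrite /energy_usage usageE. Qed.

Lemma total_energy_const (p q : 'S_n) : total_energy I p = total_energy I q.
Proof.
suff total r : total_energy I r = \sum_k position_usage k by rewrite !total.
rewrite [RHS](reindex_inj (@perm_inj _ r)).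
by apply: eq_bigr => j _; rewrite energy_usageE.
Qed.

(** Multiplying by the positive capacity turns feasibility into a comparison with the key by which
    Rule 1 sorts. *)
Lemma final_socP (p : 'S_n) j :
  (min_soc I j <= final_soc I p j) = (energy_usage I p j <= allowable_energy I j).
Proof.
case: validI => _ /(_ j)[C_gt0 _] _ _ _.
by rewrite /final_soc /allowable_energy lerBrDr -lerBrDl ler_pdivrMr // mulrC.
Qed.

Let position_usage_anti (k l : 'I_n) :
  (k <= l)%N -> position_usage l <= position_usage k.
Proof.
move=> le_kl; case: validI => D_gt0 /(_ k)[_]; rewrite usageE => delta_gt0 _.
move=> /(_ k l le_kl) le_eta _.
by rewrite /position_usage ler_wpM2l ?lerB // ltW // mulr_gt0.
Qed.

Lemma rule1_feasible (p q : 'S_n) :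
  rule1_assignment I p -> feasible I q -> feasible I p.
Proof.
move=> rule1_p feas_q v; rewrite final_socP energy_usageE leNgt.
apply/negP => lt_v.
(* Rule 1 places at or after [p v] only vehicles with allowable energy at most that of [v]; none of
   them can afford the usage at [p v] or earlier, so [q] moves them all strictly later. *)
have late (l : 'I_n) : (p v <= l)%N -> (p v < q ((p^-1)%g l))%N.
  move=> le_vl; rewrite ltnNge; apply/negP => /position_usage_anti.
  rewrite leNgt => /negP; apply.
  apply: le_lt_trans lt_v; have := rule1_p _ _ le_vl; rewrite permK.
  by apply: le_trans; rewrite -energy_usageE -final_socP.
pose tail := [set l : 'I_n | (p v <= l)%N]%SET.
(* The pigeonhole: [(p^-1 * q)%g] would map [tail] injectively into itself minus one element. *)
have sub_tail : ((p^-1 * q)%g @: tail \subset tail :\ p v)%SET.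
  apply/fintype.subsetP => _ /imsetP[l + ->]; rewrite !inE permM => /late lt_l.
  by rewrite ltnW // andbT; apply: contraTneq lt_l => ->; rewrite ltnn.
have := subset_leq_card sub_tail; rewrite card_imset; last exact: perm_inj.
by rewrite (cardsD1 (p v) tail) inE leqnn add1n ltnn.
Qed.

Lemma rule1_solves o : rule1_outcome I o -> solves I o.
Proof.
case: o => [p|] /=.
  by case=> _ feas_p; split=> // q _; rewrite (total_energy_const p q).
by case=> p rule1_p nfeas_p [q /(rule1_feasible rule1_p)].
Qed.

End Rule1.

(** * Results and costs of sequential composition *)

Section Bind.
Variables (R : realFieldType) (T U : Type).

Lemma run_bind (m : prog R T) (f : T -> prog R U) :
  run (bind m f) = run (f (run m)).
Proof. by elim: m => //=. Qed.

Lemma time_bind (m : prog R T) (f : T -> prog R U) :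
  time (bind m f) = (time m + time (f (run m)))%N.
Proof.
by elim: m => [t|o x y k IH|x y k IH|m IH] //=; rewrite ?IH ?addSn.
Qed.

End Bind.

(** * Correctness and cost of bottom-up merge sort *)

Section MergeSort.
Variables (R : realFieldType) (n : nat).
Local Notation keyed := (R * 'I_n)%type.
Implicit Types (s : seq keyed) (rs : seq (seq keyed)).

Definition key_ge : rel keyed := fun x y => y.1 <= x.1.

Lemma key_ge_total : total key_ge.
Proof. by move=> x y; apply: le_total. Qed.

Lemma run_merge_runs s1 s2 : run (merge_runs s1 s2) = merge key_ge s1 s2.
Proof.
elim: s1 s2 => [|x1 s1 IH1]; first by case.
elim=> [|x2 s2 IH2] //=; rewrite [key_ge x1 x2]/key_ge.
by case: ifP => _; rewrite run_bind /= ?IH1 // IH2.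
Qed.

(** Each element output by a comparison costs one [Leq] and one [Step]; the last [Step] finds an
    exhausted list. *)
Lemma time_merge_runs s1 s2 :
  (time (merge_runs s1 s2) <= (size s1 + size s2).*2.+1)%N.
Proof.
elim: s1 s2 => [|x1 s1 IH1]; first by case.
elim=> [|x2 s2 IH2] //=.
case: ifP => _; rewrite time_bind /= addn0.
  by have := IH1 (x2 :: s2); rewrite /=; lia.
by move: IH2 => /=; lia.
Qed.

(** [merge_pairs] consumes two runs per call, so ordinary list induction does not follow its
    recursion. *)
Lemma merge_pairs_ind (P : seq (seq keyed) -> Prop) :
  P [::] -> (forall r, P [:: r]) ->
  (forall r1 r2 rs, P rs -> P [:: r1, r2 & rs]) -> forall rs, P rs.
Proof.
move=> P0 P1 P2 rs; suff [] : P rs /\ forall r, P (r :: rs) by [].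
by elim: rs => [|r rs [IH IHr]]; split=> // r'; apply: P2.
Qed.

Lemma size_merge_pairs rs : size (run (merge_pairs rs)) = uphalf (size rs).
Proof.
by elim/merge_pairs_ind: rs => //= r1 r2 rs IH; rewrite !run_bind /= IH.
Qed.

Lemma perm_merge_pairs rs :
  perm_eq (flatten (run (merge_pairs rs))) (flatten rs).
Proof.
elim/merge_pairs_ind: rs => //= r1 r2 rs IH.
by rewrite !run_bind /= run_merge_runs catA perm_cat // perm_merge.
Qed.

Lemma sorted_merge_pairs rs :
  all (sorted key_ge) rs -> all (sorted key_ge) (run (merge_pairs rs)).
Proof.
elim/merge_pairs_ind: rs => //= r1 r2 rs IH /and3P[sr1 sr2 /IH srs].
by rewrite !run_bind /= run_merge_runs (merge_sorted key_ge_total).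
Qed.

(** Besides two units per element, each pair costs its own [Step] and the last [Step] of its merge,
    which are charged to its two runs. *)
Lemma time_merge_pairs rs :
  (time (merge_pairs rs) <= (size (flatten rs)).*2 + size rs + 1)%N.
Proof.
elim/merge_pairs_ind: rs => [|r|r1 r2 rs IH] //=; first by lia.
rewrite !time_bind /= !size_cat.
by have := time_merge_runs r1 r2; lia.
Qed.

(** From two runs on, [uphalf] strictly lowers their number, so the fuel never runs out. *)
Lemma merge_all_sorted fuel rs : (size rs <= fuel)%N ->
  all (sorted key_ge) rs ->
  perm_eq (run (merge_all fuel rs)) (flatten rs) /\
  sorted key_ge (run (merge_all fuel rs)).
Proof.
elim: fuel rs => [|fuel IH] [|r1 [|r2 rs]] //=.
- by rewrite cats0 andbT.
(* Simplification has unfolded the pass over the runs; it is folded back for [run_bind] and the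
   induction hypothesis. *)
- rewrite -[[&& _, _ & _]]/(all (sorted key_ge) [:: r1, r2 & rs]) => le_rs srs.
rewrite -[run _]/(run (bind (merge_pairs [:: r1, r2 & rs]) (merge_all fuel))).
rewrite run_bind; case: (IH (run (merge_pairs [:: r1, r2 & rs]))).
- by rewrite size_merge_pairs /=; lia.
- exact: sorted_merge_pairs.
by move=> perm_rs ?; split=> //; rewrite (perm_trans perm_rs) ?perm_merge_pairs.
Qed.

(** There are [up_log 2 (size rs)] passes, each costing one [merge_pairs] and one [Step]; the final
    [+ 1] is the [Step] that stops. *)
Lemma time_merge_all fuel rs : (size rs <= fuel)%N ->
  (time (merge_all fuel rs) <=
     up_log 2 (size rs) * ((size (flatten rs)).*2 + size rs + 2) + 1)%N.
Proof.
elim: fuel rs => [|fuel IH] [|r1 [|r2 rs]] // le_rs.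
set rs' := [:: r1, r2 & rs].
rewrite -[time _]/(time (bind (merge_pairs rs') (merge_all fuel))).+1 time_bind.
have := IH (run (merge_pairs rs')).
rewrite size_merge_pairs (perm_size (perm_merge_pairs rs')) => {}IH.
have /IH : (uphalf (size rs') <= fuel)%N by rewrite /rs' /=; move: le_rs => /=; lia.
have := time_merge_pairs rs'.
have -> : up_log 2 (size rs') = (up_log 2 (uphalf (size rs'))).+1.
  by rewrite /rs' /= up_log2S.
have : (uphalf (size rs') <= size rs')%N by lia.
move: (uphalf _) (time _) (time _) (up_log _ _) => h t1 t2 u le_h le1 le2.
rewrite mulSn; apply: leq_ltn_trans (leq_add le1 le2) _.
have : (u * ((size (flatten rs')).*2 + h + 2) <=
        u * ((size (flatten rs')).*2 + size rs' + 2))%N.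
  by rewrite leq_mul2l !leq_add2r leq_add2l le_h orbT.
move: (_ * _)%N (_ * _)%N => a b le_ba; lia.
Qed.

End MergeSort.

(** * The program carries out Rule 1, with an explicit cost *)

Section Program.
Variables (R : realFieldType) (n : nat) (I : instance R n).

Let keyed_vehicle (j : 'I_n) : R * 'I_n := (allowable_energy I j, j).

Lemma run_init_runs js :
  run (init_runs I js) = [seq [:: keyed_vehicle j] | j <- js].
Proof. by elim: js => //= j js IH; rewrite run_bind IH. Qed.

Lemma time_init_runs js : time (init_runs I js) = (3 * size js).+1.
Proof. by elim: js => //= j js IH; rewrite time_bind IH /=; lia. Qed.

Let flatten_init_runs js :
  flatten (run (init_runs I js)) = [seq keyed_vehicle j | j <- js].
Proof. by rewrite run_init_runs; elim: js => //= j js ->. Qed.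

Let merge_all_init js : let rs := run (init_runs I js) in
  exists js', [/\ perm_eq js' js,
    run (merge_all (size js) rs) = [seq keyed_vehicle j | j <- js'] &
    sorted (relpre keyed_vehicle (@key_ge R n)) js'].
Proof.
move=> rs; have size_rs : size rs = size js by rewrite /rs run_init_runs size_map.
have sorted_rs : all (sorted (@key_ge R n)) rs.
  by rewrite /rs run_init_runs; elim: (js).
have [] := merge_all_sorted (eq_leq size_rs) sorted_rs.
set s := run _; rewrite flatten_init_runs => perm_s sorted_s.
(* Sorting only permutes the pairs, so each vehicle still carries its own allowable energy. *)
have sE : s = [seq keyed_vehicle j | j <- [seq x.2 | x <- s]].
  rewrite -map_comp -[LHS]map_id; apply/eq_in_map => x.
  by rewrite (perm_mem perm_s) => /mapP[j _ ->].
exists [seq x.2 | x <- s]; split=> //; last by rewrite -sorted_map -sE.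
by have /perm_trans := perm_map snd perm_s; apply; rewrite -map_comp map_id.
Qed.

Lemma rule1_assignment_sorted (p : 'S_n) :
  sorted (relpre keyed_vehicle (@key_ge R n)) (platoon_order p) ->
  rule1_assignment I p.
Proof.
rewrite /platoon_order sorted_map => sorted_p k l le_kl.
have := @sorted_leq_nth _ _ _ _ k _ sorted_p k l.
rewrite !inE size_enum_ord !ltn_ord !nth_ord_enum; apply=> //.
- by move=> y x z; rewrite /= /key_ge => xy yz; apply: le_trans yz xy.
- by move=> x; apply: lexx.
Qed.

Let check (jk : 'I_n * 'I_n) : bool :=
  min_soc I jk.1 <= init_soc I jk.1 -
    seg_len I * usage_rate I jk.1 * (1 - reduction I jk.2) / capacity I jk.1.

Let run_check_order js ks : size js = size ks ->
  run (check_order I [seq keyed_vehicle j | j <- js] ks) =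
    if all check (zip js ks) then Some js else None.
Proof.
elim: js ks => [|j js IH] [|k ks] //= [/IH {}IH].
rewrite [check _]/check /=; case: ifP => //= _; rewrite run_bind /= IH.
by case: ifP.
Qed.

Lemma run_check_platoon_order (p : 'S_n) :
  run (check_order I [seq keyed_vehicle j | j <- platoon_order p] (enum 'I_n)) =
    if `[< feasible I p >] then Some (platoon_order p) else None.
Proof.
rewrite run_check_order ?size_map //; congr (if _ then _ else _).
apply/allP/asboolP => [checks j|feas_p].
  (* The zipped list consists of the pairs [((p^-1)%g k, k)], so it is the graph of [p]. *)
  have /checks : (j, p j) \in zip (platoon_order p) (enum 'I_n).
    rewrite /platoon_order -[X in zip _ X]map_id zip_map.
    by apply/mapP; exists (p j); rewrite ?mem_enum ?permK.
  by [].
rewrite /platoon_order -[X in zip _ X]map_id zip_map => _ /mapP[k _ ->].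
by have := feas_p ((p^-1)%g k); rewrite /final_soc /energy_usage permKV.
Qed.

(** Per vehicle: five operations, one comparison and one [Step]. *)
Lemma time_check_order s ks : (time (check_order I s ks) <= 7 * size ks + 1)%N.
Proof.
elim: s ks => [|[a j] s IH] [|k ks] //=.
by case: ifP => _ /=; rewrite ?time_bind /=; have := IH ks; lia.
Qed.

Lemma perm_platoon_order js :
  perm_eq js (enum 'I_n) -> exists p : 'S_n, js = platoon_order p.
Proof.
rewrite -[enum _]/(tval (ord_tuple n)) => /tuple_permP[p ->].
(* [tuple_permP] gives the map from positions to vehicles, while [platoon_order] expects its
   inverse. *)
exists (p^-1)%g; rewrite /platoon_order invgK /=.
by apply: eq_map => k; rewrite tnth_ord_tuple.
Qed.

Lemma run_rule1_prog : exists2 o : option 'S_n,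
  rule1_outcome I o & run (rule1_prog I) = omap (@platoon_order n) o.
Proof.
have [js [/perm_platoon_order[p ->] sE /rule1_assignment_sorted rule1_p]] :=
  merge_all_init (enum 'I_n).
exists (if `[< feasible I p >] then Some p else None).
  by case: asboolP => feas_p; [split | exists p].
move: sE; rewrite size_enum_ord => sE.
rewrite /rule1_prog !run_bind sE run_check_platoon_order.
by case: ifP.
Qed.

Lemma time_rule1_prog :
  (time (rule1_prog I) <= up_log 2 n * (3 * n + 2) + 10 * n + 3)%N.
Proof.
rewrite /rule1_prog !time_bind time_init_runs size_enum_ord.
set rs := run _; have size_rs : size rs = n.
  by rewrite /rs run_init_runs size_map size_enum_ord.
have size_flat : size (flatten rs) = n.
  by rewrite /rs flatten_init_runs size_map size_enum_ord.
have := @time_merge_all R n n rs; rewrite size_rs size_flat => /(_ (leqnn n)).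
have := time_check_order (run (merge_all n rs)) (enum 'I_n).
rewrite size_enum_ord; have -> : (n.*2 + n + 2 = 3 * n + 2)%N by lia.
by lia.
Qed.

End Program.

(** * Asymptotics of the time bound *)

Lemma up_log2_le_ln (R : realType) n : (1 < n)%N ->
  (up_log 2 n)%:R <= 2 / ln 2 * ln n%:R :> R.
Proof.
move=> n_gt1; have ln2_gt0 : 0 < ln 2 :> R by rewrite ln_gt0 // ltr1n.
(* [up_log] rounds up, so its power of 2 is below [2 * n], which is at most [n ^ 2]; this is where
   the factor 2 comes from. *)
have le_exp : (2 ^ (up_log 2 n) <= n ^ 2)%N.
  have u_gt0 : (0 < up_log 2 n)%N by rewrite up_log_gt0.
  have := up_log_gtn (isT : (1 < 2)%N) n_gt1.
  by case: (up_log 2 n) u_gt0 => //= u _ lt_n; rewrite expnS; nia.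
rewrite mulrAC ler_pdivlMr // mulr_natl mulr_natl -!lnXn ?ltr0n //; last by lia.
by rewrite -!natrX ler_ln ?posrE ?ltr0n ?ler_nat ?expn_gt0 //; lia.
Qed.

Lemma merge_sort_time_bigO (R : realType) :
  (fun n => (up_log 2 n * (3 * n + 2) + 10 * n + 3)%:R : R)
    =O_\oo (fun n : nat => n%:R * ln n%:R).
Proof.
(* With [u = up_log 2 n >= 1] and [n >= 2], the terms [3nu], [2u <= nu], [10n <= 10nu] and
   [3 <= 3nu] add up to at most [17nu]. *)
apply/eqO_exP; exists (17 * (2 / ln 2)).
  by rewrite mulr_gt0 // divr_gt0 // ln_gt0 // ltr1n.
(* The range starts at 2 because [ln 1 = 0] while the bound is positive at 1. *)
exists 2 => // n /= n_gt1; have ln_n : 0 <= ln n%:R :> R.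
  by rewrite ln_ge0 // ler1n; lia.
rewrite normr_nat ger0_norm ?mulr_ge0 //.
have /le_trans : ((up_log 2 n * (3 * n + 2) + 10 * n + 3)%:R <=
    17 * (n%:R * (up_log 2 n)%:R) :> R).
  rewrite -!natrM ler_nat; have : (0 < up_log 2 n)%N by rewrite up_log_gt0.
  by move: (up_log _ _) n_gt1 => u; nia.
apply; rewrite -mulrA ler_wpM2l // [leRHS]mulrCA ler_wpM2l //.
exact: up_log2_le_ln.
Qed.

Theorem proposition2 (R : realType) :
  exists T : nat -> R,
    T =O_\oo (fun n : nat => n%:R * ln n%:R) /\
    forall (n : nat) (I : instance R n) (delta : R),
      valid_instance I ->
      (forall j : 'I_n, usage_rate I j = delta) ->
      [/\ forall o : option 'S_n, rule1_outcome I o -> solves I o,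
          exists2 o : option 'S_n,
            rule1_outcome I o & run (rule1_prog I) = omap (@platoon_order n) o
        & (time (rule1_prog I))%:R <= T n].
Proof.
exists (fun n => (up_log 2 n * (3 * n + 2) + 10 * n + 3)%:R).
split; first exact: merge_sort_time_bigO.
move=> n I delta validI usageE; split.
- exact: rule1_solves validI usageE.
- exact: run_rule1_prog.
- by rewrite ler_nat time_rule1_prog.
Qed.
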